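(* Let $X\in\mathbb{R}^{m\times n}$ have $\mathrm{rank}(X)=n$ and singular values $\sigma_1(X)\ge\cdots\ge\sigma_n(X)\ge 1$, and let $k$ be a fixed integer with $0<k<n$. Let $X_k^*\in\mathbb{R}^{m\times k}$ be a column submatrix of $X$ that maximizes $\log\mathrm{vol}(B)$ among all column submatrices $B\in\mathbb{R}^{m\times k}$ of $X$. Then the Gu–Eisenstat QR column selection algorithm with relaxation factor $\eta=1$ is a 1-interchange algorithm for maximizing the log-volume, and its output matrix $X_k\equiv X_{\mathcal{S}}$ satisfies $$0\le\log\mathrm{vol}(X_k^* )-\log\mathrm{vol}(X_k)\le\frac{k-1}{2k-1}\log\mathrm{vol}(X_k^* ),$$ where $\frac{k-1}{2k-1}<\frac12$. Moreover, the upper bound is tight (holds with equality) for matrices $X$ with orthonormal columns.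
   Context: For $\mathcal{S}\subset\{1,\ldots,n\}$, $X_{\mathcal{S}}$ is the submatrix of $X$ consisting of the columns indexed by $\mathcal{S}$. $\mathrm{vol}(B)=\sqrt{\det(B^TB)}$, the product of the singular values, for a matrix $B$ with full column rank; a matrix with linearly dependent columns has volume $0$. Gu–Eisenstat QR column selection. Input: $X\in\mathbb{R}^{m\times n}$, an integer $0<k\le\mathrm{rank}(X)$, a relaxation factor $\eta\ge1$. Start with any $\mathcal{S}\subset\{1,\ldots,n\}$ with $|\mathcal{S}|=k$ and $\mathrm{rank}(X_{\mathcal{S}})=k$. As long as there are $i\in\mathcal{S}$ and $j\in\{1,\ldots,n\}-\mathcal{S}$ such that $\mathcal{T}=(\mathcal{S}-\{i\})\cup\{j\}$ satisfies $\mathrm{vol}(X_{\mathcal{T}})>\eta\,\mathrm{vol}(X_{\mathcal{S}})$, replace $\mathcal{S}$ by such a $\mathcal{T}$. When no such swap exists, output the $m\times k$ column submatrix $X_{\mathcal{S}}$. 1-interchange algorithm for a set function $f$ on $\{1,\ldots,n\}$: start with a $k$-element set $\mathcal{S}$; while there are $x\in\mathcal{S}$ and $y\notin\mathcal{S}$ with $f((\mathcal{S}-\{x\})\cup\{y\})>f(\mathcal{S})$, replace $\mathcal{S}$ by $(\mathcal{S}-\{x\})\cup\{y\}$; output $\mathcal{S}$ when no such pair exists. Here $f(\mathcal{S})=\log\mathrm{vol}(X_{\mathcal{S}})$. *)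

(* Defs.v *)
From HB Require Import structures.
From mathcomp Require Import all_boot all_order all_algebra.
From mathcomp Require Import reals exp.
Set Implicit Arguments.
Unset Strict Implicit.
Unset Printing Implicit Defensive.
Import Order.TTheory GRing.Theory Num.Theory.
Local Open Scope ring_scope.

Section Volume.
Variable R : realType.

Definition colset m n (X : 'M[R]_(m, n)) (S : {set 'I_n}) : 'M[R]_(m, #|S|) :=
  colsub (@enum_val _ (mem S)) X.

Definition vol m p (B : 'M[R]_(m, p)) : R := Num.sqrt (\det (B^T *m B)).

(* As [ln 0 = 0] here, this is the logarithm of the volume only when the
   columns of [B] are linearly independent. *)
Definition logvol m p (B : 'M[R]_(m, p)) : R := ln (vol B).

(* The squares of the singular values are the eigenvalues of [X^T *m X], with
   multiplicity; when [m < n], the other [n - m] eigenvalues are [0]. *)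
Definition singular_values m n (X : 'M[R]_(m, n)) (s : seq R) : Prop :=
  [/\ size s = minn m n,
      sorted >=%R s,
      all (fun x => 0 <= x) s
    & char_poly (X^T *m X) =
        'X^(n - minn m n) * \prod_(x <- s) ('X - (x ^+ 2)%:P)].

Definition max_logvol m n (X : 'M[R]_(m, n)) (k : nat) (S : {set 'I_n}) : Prop :=
  #|S| = k /\
  forall T : {set 'I_n}, #|T| = k -> logvol (colset X T) <= logvol (colset X S).

End Volume.

(* A nondeterministic algorithm: it starts in any state satisfying [start], and
   makes [step]s, chosen arbitrarily, until none is possible. *)
Record search (T : finType) := Search { start : pred T; step : rel T }.

Definition output (T : finType) (A : search T) (s : T) : bool :=
  [exists s0, start A s0 && connect (step A) s0 s] && [forall t, ~~ step A s t].

Definition same_search (T : finType) (A B : search T) : Prop :=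
  start A =1 start B /\ step A =2 step B.

Definition swap_rel n (better : rel {set 'I_n}) : rel {set 'I_n} :=
  fun S T => [exists i in S, exists j in ~: S,
    (T == j |: (S :\ i)) && better S T].

Definition one_interchange (R : realType) n (k : nat) (f : {set 'I_n} -> R) :
    search {set 'I_n} :=
  Search (fun S : {set 'I_n} => #|S| == k) (swap_rel (fun S T => f S < f T)).

Definition gu_eisenstat (R : realType) m n (X : 'M[R]_(m, n)) (k : nat) (eta : R) :
    search {set 'I_n} :=
  Search (fun S : {set 'I_n} => (#|S| == k) && (\rank (colset X S) == k))
         (swap_rel (fun S T => eta * vol (colset X S) < vol (colset X T))).

(* Main.v *)
Require Import Defs.
From mathcomp Require Import all_boot all_order all_algebra.
From mathcomp Require Import reals exp.
From mathcomp Require Import perm complex lra.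
Set Implicit Arguments.
Unset Strict Implicit.
Unset Printing Implicit Defensive.
Import Order.TTheory GRing.Theory Num.Theory.
Local Open Scope ring_scope.

(** The log-volume f(S) of the columns indexed by S is a nondecreasing,
    submodular set function with f(set0) = 0, and the bound is the guarantee
    of Nemhauser, Wolsey and Fisher for local search on such functions.

    Geometry.  Adding a column j to S multiplies the Gram determinant by the
    squared distance from that column to the span of the columns in S
    ([gram_det_setU1]).  This distance can only shrink when S grows, which is
    submodularity ([logvol_submodular]).  It is also at least 1: the distance
    is the norm of X c for some c with c_j = 1, and X does not shrink vectors,
    because the eigenvalues of X^T X, the squared singular values, are at
    least 1 ([singular_values_expand], from the spectral theorem).  So f is
    nondecreasing ([logvol_nondecreasing]), and every volume is positive; the
    swap tests vol S < vol T and log vol S < log vol T then agree, and every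
    k columns are independent, so the two algorithms coincide.

    Combinatorics ([interchange_bound]).  Let S be locally optimal, A any set
    of size k, j0 in A, i in S and B = (S - i) + j0.  Then f(B) <= f(S), and
    each of the k - 1 other elements j of A has a marginal value over B that
    is at most the one over S - i, hence at most f(S) - f(S - i).  So
      f(A) <= f(S) + (k - 1) (f(S) - f(S - i)).
    By submodularity the losses f(S) - f(S - i) sum to at most f(S) over all
    i in S; averaging gives k f(A) <= (2 k - 1) f(S), which is the claim.

    With orthonormal columns every Gram matrix is the identity, all
    log-volumes vanish, and both sides of the bound are 0. *)

(** * Local search on submodular functions *)

Section Interchange.
Variables (R : realFieldType) (T : finType) (f : {set T} -> R).

Definition nondecreasing_set := forall (A : {set T}) j,
  j \notin A -> f A <= f (j |: A).

Definition submodular := forall (A B : {set T}) j,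
  A \subset B -> j \notin B -> f (j |: B) - f B <= f (j |: A) - f A.

Hypotheses (f_mono : nondecreasing_set) (f_sub : submodular).

Lemma nondecreasing_setU1 A j : f A <= f (j |: A).
Proof.
by have [jA|/f_mono//] := boolP (j \in A); rewrite (setUidPr _) ?sub1set.
Qed.

Lemma nondecreasing_setU A B : f A <= f (A :|: B).
Proof.
have [p] := ubnP #|B|; elim: p B => // p IH B; rewrite ltnS => leBp.
have [->|[j jB]] := set_0Vmem B; first by rewrite setU0.
rewrite -(setD1K jB) setUCA; apply: le_trans (nondecreasing_setU1 _ _).
by apply: IH; move: leBp; rewrite (cardsD1 j) jB.
Qed.

(** Adding the elements of B one at a time, each marginal value is at most
    the marginal value over A alone. *)
Lemma submodularU A B :
  f (A :|: B) - f A <= \sum_(j in B) (f (j |: A) - f A).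
Proof.
have [p] := ubnP #|B|; elim: p B => // p IH B; rewrite ltnS => leBp.
have [->|[j jB]] := set_0Vmem B; first by rewrite big_set0 setU0 subrr.
have {}/IH IH : (#|B :\ j| < p)%N by move: leBp; rewrite (cardsD1 j) jB.
rewrite (big_setD1 j jB) /= -{1}(setD1K jB) setUCA.
have [jA|jA] := boolP (j \in A).
  have j1 (C : {set T}) : j \in C -> j |: C = C.
    by move=> jC; apply/setUidPr; rewrite sub1set.
  by rewrite (j1 A jA) (j1 (A :|: _)) ?inE ?jA // subrr add0r.
have := @f_sub A (A :|: (B :\ j)) j; rewrite subsetUl !inE eqxx (negPf jA) /=.
by move=> /(_ isT isT); lra.
Qed.

(** Build S up from the empty set: the gain of i when it is added is at least
    the loss caused by removing i from the whole of S, and the gains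
    telescope. *)
Lemma submodular_sum_removal (S : {set T}) :
  \sum_(i in S) (f S - f (S :\ i)) <= f S - f set0.
Proof.
(* The induction is on the part A of S that has been built up so far. *)
suff H (A : {set T}) :
    A \subset S -> \sum_(i in A) (f S - f (S :\ i)) <= f A - f set0.
  exact: H.
have [p] := ubnP #|A|; elim: p A => // p IH A; rewrite ltnS => leAp sAS.
have [->|[j jA]] := set_0Vmem A; first by rewrite big_set0 subrr.
have {}/IH IH : (#|A :\ j| < p)%N by move: leAp; rewrite (cardsD1 j) jA.
rewrite (big_setD1 j jA) /=.
have /IH {}IH : A :\ j \subset S by rewrite (subset_trans _ sAS) ?subsetDl.
have := @f_sub (A :\ j) (S :\ j) j; rewrite setSD // !inE eqxx /=.
by rewrite !setD1K ?(subsetP sAS) // => /(_ isT isT); lra.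
Qed.

(** Exchanging i for one element of A before the other elements are added is
    what yields the factor #|S| - 1; adding all of A to S directly would only
    give f A <= 2 f S. *)
Theorem interchange_bound (S A : {set T}) :
  0 <= f set0 -> #|A| = #|S| -> (0 < #|S|)%N ->
  (forall i j, i \in S -> j \notin S -> f (j |: (S :\ i)) <= f S) ->
  #|S|%:R * f A <= (2 * #|S|%:R - 1) * f S.
Proof.
move=> f0 cardA S_gt0 opt.
have [j0 j0A] : exists j0, j0 \in A by apply/card_gt0P; rewrite cardA.
(* Exchanges for a j already in S also do not increase f, by monotonicity,
   so A may meet S. *)
have swap i j : i \in S -> f (j |: (S :\ i)) <= f S.
  move=> iS; have [jS|jS] := boolP (j \in S); last exact: opt.
  have SE : i |: (j |: (S :\ i)) = S.
    by rewrite setUCA setD1K //; apply/setUidPr; rewrite sub1set.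
  by rewrite -[leRHS]/(f S) -{2}SE nondecreasing_setU1.
have step i : i \in S -> f A <= f S + (#|S|%:R - 1) * (f S - f (S :\ i)).
  move=> iS; set B := j0 |: (S :\ i).
  have sAB : f A <= f (B :|: (A :\ j0)).
    rewrite /B setUAC setD1K //; exact: nondecreasing_setU.
  have sum_le : f (B :|: (A :\ j0)) - f B
      <= (#|S|%:R - 1) * (f S - f (S :\ i)).
    have -> : #|S|%:R - 1 = (#|A :\ j0|)%:R :> R.
      by rewrite -cardA (cardsD1 j0) j0A natrD addrC addKr.
    rewrite mulr_natl -sumr_const; apply: le_trans (submodularU _ _) _.
    apply: ler_sum => j _.
    have [jB|jB] := boolP (j \in B).
      rewrite (setUidPr _) ?sub1set // subrr subr_ge0.
      by rewrite -{2}(setD1K iS) nondecreasing_setU1.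
    apply: (@le_trans _ _ (f (j |: (S :\ i)) - f (S :\ i))).
      exact: f_sub (subsetUr _ _) jB.
    by rewrite lerD2r swap.
  have : f B <= f S by exact: swap.
  by lra.
have : \sum_(i in S) f A
   <= \sum_(i in S) (f S + (#|S|%:R - 1) * (f S - f (S :\ i))).
  exact: ler_sum.
rewrite big_split /= -mulr_sumr !sumr_const.
rewrite -[f A *+ _]mulr_natl -[f S *+ _]mulr_natl.
have k1 : 0 <= #|S|%:R - 1 :> R by rewrite subr_ge0 ler1n.
have removal : \sum_(i in S) (f S - f (S :\ i)) <= f S.
  by apply: le_trans (submodular_sum_removal S) _; rewrite gerBl.
by have := ler_wpM2l k1 removal; lra.
Qed.

End Interchange.

(** * Symmetric matrices with eigenvalues bounded below *)

Section Rayleigh.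
Variable R : rcfType.
Local Open Scope complex_scope.
Local Open Scope sesquilinear_scope.

Local Notation toC := (real_complex R).

(** In an orthonormal eigenbasis, which exists over the complex numbers, the
    quadratic form is a combination of the squared moduli of the coordinates,
    weighted by the eigenvalues; these are real. *)
Lemma symmetric_form_ge n (A : 'M[R]_n) (a : R) :
  A^T = A -> (forall x, eigenvalue A x -> a <= x) ->
  forall c : 'rV[R]_n, a * (c *m c^T) 0 0 <= (c *m A *m c^T) 0 0.
Proof.
move=> symA eigA c.
pose B := map_mx toC A.
have Breal : B \is a realmx.
  by apply/mxOverP => i j; rewrite mxE; apply/complex_realP; exists (A i j).
have Bherm : B \is hermsymmx.
  apply: realsym_hermsym => //; apply/is_hermitianmxP.
  by rewrite expr0 scale1r map_mx_id // map_trmx symA.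
have /orthomx_spectralP := hermitian_normalmx Bherm.
have := hermitian_spectral_diag_real Bherm.
have := spectral_unitarymx B; have := spectral_unit B.
move: (spectralmx B) (spectral_diag B) => P d Punit Punitary dreal BE.
have PB : P *m B = diag_mx d *m P by rewrite [in LHS]BE !mulmxA mulmxV ?mul1mx.
(* The rows of P are eigenvectors. *)
have d_ge i : toC a <= d 0 i.
  have /complex_realP[x dx] : d 0 i \is Num.real by exact: (mxOverP dreal).
  rewrite dx lecR; apply: eigA; rewrite eigenvalue_root_char.
  rewrite -(fmorph_root toC) map_char_poly -eigenvalue_root_char.
  apply/eigenvalueP; exists (row i P).
    by rewrite -row_mul PB row_mul row_diag_mx -scalemxAl -rowE dx.
  apply/negP => /eqP Pi0; have := Punit; rewrite -row_free_unit => /row_freeP[Q].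
  move=> /(congr1 (row i)); rewrite row_mul Pi0 mul0mx => /rowP/(_ i).
  by rewrite !mxE eqxx => /eqP; rewrite eq_sym oner_eq0.
pose u := map_mx toC c; pose w := u *m P^t*.
have uE : map_mx toC c^T = u^t*.
  by apply/matrixP=> i j; rewrite !mxE; apply/esym/conjc_real.
have wE : w^t* = P *m u^t* by rewrite /w trmx_mul map_mxM trmxCK.
rewrite -lecR rmorphM /=.
have -> : toC ((c *m c^T) 0 0) = \sum_i w 0 i * (w 0 i)^*.
  have -> : toC ((c *m c^T) 0 0) = (u *m u^t*) 0 0.
    by rewrite -uE -map_mxM [RHS]mxE.
  have -> : u *m u^t* = w *m w^t*.
    by rewrite wE /w -mulmxA (mulmxA _ P) -invmx_unitary // mulVmx ?mul1mx.
  by rewrite mxE; apply: eq_bigr => i _; rewrite !mxE.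
have -> : toC ((c *m A *m c^T) 0 0) = \sum_i d 0 i * (w 0 i * (w 0 i)^*).
  have -> : toC ((c *m A *m c^T) 0 0) = (u *m B *m u^t*) 0 0.
    by rewrite -uE -!map_mxM [RHS]mxE.
  have -> : u *m B *m u^t* = w *m (diag_mx d *m w^t*).
    by rewrite BE wE /w -invmx_unitary // !mulmxA.
  rewrite mxE; apply: eq_bigr => i _.
  by rewrite mul_diag_mx !mxE mulrCA.
rewrite mulr_sumr; apply: ler_sum => i _.
by rewrite ler_wpM2r ?d_ge ?mul_conjC_ge0.
Qed.
End Rayleigh.

(** * Gram determinants and the log-volume *)

Section Gram.
Variables (R : realType) (m n : nat) (X : 'M[R]_(m, n)).

Definition gram_det (S : {set 'I_n}) : R :=
  \det ((colset X S)^T *m colset X S).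

Definition sqnorm p (v : 'cV[R]_p) : R := \sum_i v i 0 ^+ 2.

Lemma sqnormE p (v : 'cV[R]_p) : sqnorm v = (v^T *m v) 0 0.
Proof. by rewrite mxE; apply: eq_bigr => i _; rewrite !mxE expr2. Qed.

Lemma sqnorm_ge0 p (v : 'cV[R]_p) : 0 <= sqnorm v.
Proof. by apply: sumr_ge0 => i _; apply: sqr_ge0. Qed.

Lemma sqnormD_orth p (u v : 'cV[R]_p) :
  (v^T *m u) 0 0 = 0 -> sqnorm (u + v) = sqnorm u + sqnorm v.
Proof.
move=> vu0; have uv0 : (u^T *m v) 0 0 = 0.
  by rewrite -[v]trmxK -trmx_mul mxE.
rewrite !sqnormE [(u + v)^T]raddfD mulmxDl !mulmxDr.
by rewrite mxE [X in X + _]mxE [X in _ + X]mxE vu0 uv0 addr0 add0r.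
Qed.

(** The Gram determinant does not depend on the order of the columns: a
    reordering multiplies it by the square of a sign. *)
Lemma gram_det_enum p (f : 'I_p -> 'I_n) : injective f ->
  \det ((colsub f X)^T *m colsub f X) = gram_det [set f i | i : 'I_p].
Proof.
move=> f_inj; set S := [set f i | i : 'I_p].
have mem_f i : f i \in S by apply: imset_f.
have : p = #|S| by rewrite card_imset // card_ord.
move: S mem_f => S mem_f pS; subst p.
pose s i := enum_rank_in (mem_f i) (f i).
have sK i : enum_val (s i) = f i by rewrite enum_rankK_in.
have s_inj : injective s by move=> i j /(congr1 enum_val); rewrite !sK => /f_inj.
have -> : colsub f X = colset X S *m perm_mx (perm s_inj)^-1.
  by rewrite -col_permE; apply/matrixP => i j; rewrite !mxE permE sK.
rewrite trmx_mul !mulmxA -(mulmxA _ _ (colset X S)) !det_mulmx det_tr mulrC.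
by rewrite mulrA det_perm -expr2 sqrr_sign mul1r.
Qed.

(** Here X c is the residual of column j after orthogonal projection onto the
    span of the columns in S, so its squared norm is the squared distance to
    that span.  Writing it as X c, with c a coefficient vector supported on
    j |: S, makes the residuals for different S comparable. *)
Lemma gram_det_setU1 (S : {set 'I_n}) j : j \notin S -> gram_det S != 0 ->
  exists2 c : 'cV[R]_n, c j 0 = 1 /\ (forall i, i \notin j |: S -> c i 0 = 0)
    & (forall i, i \in S -> (X^T *m (X *m c)) i 0 = 0)
      /\ gram_det (j |: S) = sqnorm (X *m c) * gram_det S.
Proof.
move=> jS S_neq0; pose Y := colset X S; pose E := colset (1%:M : 'M[R]_n) S.
have XE : X *m E = Y.
  by rewrite /E /colset mulmx_colsub mulmx1.
have Gunit : Y^T *m Y \in unitmx by rewrite unitmxE unitfE.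
(* The normal equations of the least squares problem. *)
pose w := invmx (Y^T *m Y) *m (Y^T *m col j X).
pose c : 'cV[R]_n := delta_mx j 0 - E *m w.
have Ew i : i \notin S -> (E *m w) i 0 = 0.
  move=> iS; rewrite mxE big1 // => k _; rewrite !mxE.
  case: eqP => [ik|]; last by rewrite mul0r.
  by rewrite ik enum_valP in iS.
have Xc : X *m c = col j X - Y *m w.
  by rewrite mulmxBr mulmxA XE -colE.
have orth : Y^T *m (X *m c) = 0.
  by rewrite Xc mulmxBr mulmxA /w mulKVmx // subrr.
have cE i : i \notin S -> c i 0 = (i == j)%:R.
  by move=> iS; rewrite [LHS]mxE [X in _ + X]mxE Ew // subr0 mxE andbT.
exists c; split.
- by rewrite cE // eqxx.
- by move=> i; rewrite in_setU1 negb_or => /andP[/negPf ij iS]; rewrite cE ?ij.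
- move=> i iS; have /matrixP/(_ (enum_rank_in iS i) 0) := orth.
  rewrite [RHS]mxE => <-; rewrite !mxE; apply: eq_bigr => a _.
  by rewrite !mxE enum_rankK_in.
(* List j before S, so that the Gram matrix gets a block form. *)
pose f (i : 'I_(1 + #|S|)) : 'I_n :=
  match split i with inl _ => j | inr k => enum_val k end.
have fl i : f (lshift _ i) = j by rewrite /f (unsplitK (inl i)).
have fr i : f (rshift 1 i) = enum_val i by rewrite /f (unsplitK (inr i)).
have f_inj : injective f.
  move=> a b; rewrite -[a]splitK -[b]splitK.
  case: (split a) => a'; case: (split b) => b' /=; rewrite ?fl ?fr.
  - by rewrite (ord1 a') (ord1 b').
  - by move=> jE; rewrite jE enum_valP in jS.
  - by move=> jE; rewrite -jE enum_valP in jS.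
  - by move=> /enum_val_inj ->.
have -> : j |: S = [set f i | i : 'I_(1 + #|S|)].
  apply/setP => i; apply/setU1P/imsetP => [[->|iS]|[a _ ->]].
  - by exists (lshift _ ord0); rewrite ?fl.
  - exists (rshift 1 (enum_rank_in iS i)) => //.
    by rewrite fr enum_rankK_in.
  - rewrite -[a]splitK; case: (split a) => a' /=; rewrite ?fl ?fr; first by left.
    by right; apply: enum_valP.
rewrite -gram_det_enum //.
have -> : colsub f X = row_mx (col j X) Y.
  apply/matrixP => a b; rewrite -[b]splitK.
  by case: (split b) => b' /=; rewrite ?row_mxEl ?row_mxEr !mxE ?fl ?fr.
(* The unimodular column operation L replaces column j by its residual; the
   Gram matrix becomes block triangular. *)
pose L := block_mx (1%:M : 'M[R]_1) 0 (- w) (1%:M : 'M[R]_#|S|).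
have detL : \det L = 1 by rewrite det_lblock !det1 mulr1.
have rowL : row_mx (col j X) Y *m L = row_mx (X *m c) Y.
  by rewrite mul_row_block !mulmx1 mulmx0 add0r mulmxN -Xc.
set G := (X in \det X); have <- : \det (L^T *m G *m L) = \det G.
  by rewrite !det_mulmx det_tr detL mul1r mulr1.
rewrite /G mulmxA -trmx_mul rowL -mulmxA rowL tr_row_mx mul_col_row orth.
by rewrite det_ublock det_mx11 -sqnormE.
Qed.

Hypothesis X_expand : forall c : 'cV[R]_n, sqnorm c <= sqnorm (X *m c).

Lemma sqnorm_ge1 (c : 'cV[R]_n) j : c j 0 = 1 -> 1 <= sqnorm (X *m c).
Proof.
move=> cj; apply: le_trans (X_expand c); rewrite /sqnorm (bigD1 j) //= cj.
by rewrite expr1n lerDl sumr_ge0 // => i _; apply: sqr_ge0.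
Qed.

Lemma gram_det0 : gram_det set0 = 1.
Proof.
rewrite /gram_det; move: (colset X set0); rewrite cards0 => Y.
exact: det_mx00.
Qed.

Lemma gram_det_gt0 S : 0 < gram_det S.
Proof.
have [p] := ubnP #|S|; elim: p S => // p IH S; rewrite ltnS => leSp.
have [->|[j jS]] := set_0Vmem S; first by rewrite gram_det0.
have {}/IH IH : (#|S :\ j| < p)%N by move: leSp; rewrite (cardsD1 j) jS.
have [|c [cj _] [_]] := @gram_det_setU1 (S :\ j) j _ (lt0r_neq0 IH).
  by rewrite !inE eqxx.
rewrite setD1K // => ->; rewrite mulr_gt0 //.
exact: lt_le_trans ltr01 (sqnorm_ge1 cj).
Qed.

Lemma vol_gt0 S : 0 < vol (colset X S).
Proof. by rewrite sqrtr_gt0 gram_det_gt0. Qed.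

Lemma logvol_setU1 S j d : 0 < d -> gram_det (j |: S) = d * gram_det S ->
  logvol (colset X (j |: S)) - logvol (colset X S) = ln (Num.sqrt d).
Proof.
move=> d0 dE; rewrite /logvol {1}/vol -/(gram_det _) dE sqrtrM ?ltW //.
rewrite lnM ?posrE ?vol_gt0 ?sqrtr_gt0 ?gram_det_gt0 //.
by rewrite addrK.
Qed.

Lemma logvol_nondecreasing : nondecreasing_set (fun S => logvol (colset X S)).
Proof.
move=> S j jS; rewrite -subr_ge0.
have [c [cj _] [_ cE]] := gram_det_setU1 jS (lt0r_neq0 (gram_det_gt0 S)).
have c1 := sqnorm_ge1 cj.
rewrite (logvol_setU1 _ cE) ?(lt_le_trans ltr01) // ln_ge0 //.
by rewrite -sqrtr1 ler_wsqrtr.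
Qed.

(** For A included in B, the residual of j over A is the residual over B plus
    a vector in the span of the columns in B.  The residual over B is
    orthogonal to that span, so by Pythagoras it is the shorter one. *)
Lemma logvol_submodular : submodular (fun S => logvol (colset X S)).
Proof.
move=> A B j sAB jB.
have jA : j \notin A by apply: contra jB; apply: subsetP.
have [a [aj a0] [a_orth aE]] := gram_det_setU1 jA (lt0r_neq0 (gram_det_gt0 A)).
have [b [bj b0] [b_orth bE]] := gram_det_setU1 jB (lt0r_neq0 (gram_det_gt0 B)).
have a_gt0 := lt_le_trans ltr01 (sqnorm_ge1 aj).
have b_gt0 := lt_le_trans ltr01 (sqnorm_ge1 bj).
rewrite (logvol_setU1 _ aE) // (logvol_setU1 _ bE) //.
rewrite ler_ln ?posrE ?sqrtr_gt0 // ler_wsqrtr //.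
have -> : X *m a = X *m b + X *m (a - b) by rewrite -mulmxDr addrC subrK.
rewrite [leRHS]sqnormD_orth ?lerDl ?sqnorm_ge0 //.
rewrite trmx_mul -mulmxA mxE big1 // => i _.
have [iB|iB] := boolP (i \in B); first by rewrite b_orth // mulr0.
rewrite !mxE; have [->|ij] := eqVneq i j; first by rewrite aj bj subrr mul0r.
rewrite a0 ?b0 ?subrr ?mul0r // in_setU1 negb_or ij ?iB //.
by apply: contra iB; apply: subsetP.
Qed.

End Gram.

(** * Outputs of the algorithms *)

Lemma eq_output (T : finType) (A B : search T) :
  same_search A B -> output A =1 output B.
Proof.
move=> [eqS eqR] s; rewrite /output; congr (_ && _).
  by apply: eq_existsb => s0; rewrite eqS (eq_connect eqR).
by apply: eq_forallb => t; rewrite eqR.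
Qed.

Lemma swap_relP n (better : rel {set 'I_n}) (S T : {set 'I_n}) :
  reflect (exists i j, [/\ i \in S, j \notin S, T = j |: (S :\ i) & better S T])
    (swap_rel better S T).
Proof.
apply: (iffP exists_inP) => [[i iS /exists_inP[j jS /andP[/eqP TE bST]]]|].
  by exists i, j; split=> //; rewrite inE in jS.
move=> [i [j [iS jS TE bST]]]; exists i => //; apply/exists_inP; exists j.
  by rewrite inE.
by rewrite bST TE eqxx.
Qed.

Lemma card_swap n (S : {set 'I_n}) i j :
  i \in S -> j \notin S -> #|j |: (S :\ i)| = #|S|.
Proof.
move=> iS jS; rewrite cardsU1 !inE (negPf jS) andbF.
by rewrite (cardsD1 i S) iS.
Qed.

Lemma output_one_interchange (R : realType) n k (f : {set 'I_n} -> R)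
    (S : {set 'I_n}) :
  output (one_interchange k f) S ->
  #|S| = k /\
  (forall i j, i \in S -> j \notin S -> f (j |: (S :\ i)) <= f S).
Proof.
move=> /andP[/existsP[S0 /andP[/= cardS0 S0S]] /forallP stuck]; split.
  pose a := [pred U : {set 'I_n} | #|U| == k].
  have a_closed : closed (swap_rel (fun S T => f S < f T)) a.
    by move=> U V /swap_relP[i [j [iU jU -> _]]]; rewrite !inE card_swap.
  by have := closed_connect a_closed S0S; rewrite !inE cardS0 => /esym/eqP.
move=> i j iS jS; rewrite leNgt; apply/negP => lt_f.
have /negP := stuck (j |: (S :\ i)); apply.
by apply/swap_relP; exists i, j.
Qed.

(** * Volumes under the singular value hypothesis *)

(** The rank forces n <= m, so all n eigenvalues of X^T X are squares of
    entries of sigma, and the last entry of sigma is the least. *)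
Lemma singular_values_expand (R : realType) m n (X : 'M[R]_(m, n)) sigma :
  \rank X = n -> singular_values X sigma -> 1 <= sigma`_n.-1 ->
  forall c : 'cV[R]_n, sqnorm c <= sqnorm (X *m c).
Proof.
move=> rkX [size_s sorted_s _ charX] sigma1 c.
have le_nm : (n <= m)%N by rewrite -rkX rank_leq_row.
have mnE : minn m n = n by apply/minn_idPr.
rewrite mnE in size_s charX; rewrite subnn expr0 mul1r in charX.
have s_ge1 x : x \in sigma -> 1 <= x.
  move=> xs; apply: le_trans sigma1 _; rewrite -(nth_index 0 xs).
  have lt_i : (index x sigma < n)%N by rewrite -size_s index_mem.
  have n0 : (0 < n)%N by case: (n) lt_i.
  have trans_ge : transitive (>=%R : rel R).
    by move=> ? ? ? *; apply: ge_trans; eassumption.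
  apply: (sorted_leq_nth trans_ge (@lexx _ R)) => //.
  - by rewrite inE size_s.
  - by rewrite inE size_s prednK.
  - by rewrite -ltnS prednK.
have symG : (X^T *m X)^T = X^T *m X by rewrite trmx_mul trmxK.
have eig x : eigenvalue (X^T *m X) x -> 1 <= x.
  rewrite eigenvalue_root_char charX.
  rewrite -(big_map (fun y => y ^+ 2) xpredT (fun y => 'X - y%:P)).
  by rewrite root_prod_XsubC => /mapP[y ys ->]; rewrite exprn_ege1 ?s_ge1.
have := symmetric_form_ge symG eig c^T.
by rewrite mul1r trmxK !sqnormE trmx_mul !mulmxA.
Qed.

Lemma orthonormal_logvol (R : realType) m n (X : 'M[R]_(m, n)) :
  X^T *m X = 1%:M -> forall S, logvol (colset X S) = 0.
Proof.
move=> XX S; rewrite /logvol /vol.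
have -> : (colset X S)^T *m colset X S = 1%:M.
  apply/matrixP => a b; have /matrixP/(_ (enum_val a) (enum_val b)) := XX.
  rewrite !mxE (inj_eq enum_val_inj) => <-.
  by apply: eq_bigr => i _; rewrite !mxE.
by rewrite det1 sqrtr1 ln1.
Qed.

Theorem theorem5p1 (R : realType) (m n k : nat) (hk : (0 < k < n)%N) :
  (forall (X : 'M[R]_(m, n)) (sigma : seq R),
     \rank X = n ->
     singular_values X sigma ->
     1 <= sigma`_n.-1 ->
     [/\ same_search (gu_eisenstat X k 1)
           (one_interchange k (fun S => logvol (colset X S))),
         (forall Sopt S : {set 'I_n},
            max_logvol X k Sopt ->
            output (gu_eisenstat X k 1) S ->
            0 <= logvol (colset X Sopt) - logvol (colset X S)
              <= (k%:R - 1) / (2 * k%:R - 1) * logvol (colset X Sopt))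
       & (k%:R - 1) / (2 * k%:R - 1) < 1 / 2 :> R])
  /\
  (forall X : 'M[R]_(m, n),
     X^T *m X = 1%:M ->
     forall Sopt S : {set 'I_n},
       max_logvol X k Sopt ->
       output (gu_eisenstat X k 1) S ->
       logvol (colset X Sopt) - logvol (colset X S)
         = (k%:R - 1) / (2 * k%:R - 1) * logvol (colset X Sopt)).
Proof.
have [k_gt0 _] := andP hk; split; last first.
  by move=> X XX Sopt S _ _; rewrite !orthonormal_logvol // subrr mulr0.
move=> X sigma rkX svX sigma1.
have k1 : 1 <= k%:R :> R by rewrite ler1n.
have d_gt0 : 0 < 2 * k%:R - 1 :> R by lra.
have X_expand := singular_values_expand rkX svX sigma1.
have sameX : same_search (gu_eisenstat X k 1)
    (one_interchange k (fun S => logvol (colset X S))).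
  split=> [S|S T] /=.
    apply/andP/idP => [[]//|cS]; split=> //; rewrite -(eqP cS) eqn_leq.
    rewrite rank_leq_col /=.
    have := mxrankM_maxr (colset X S)^T (colset X S).
    by rewrite mxrank_unit // unitmxE unitfE lt0r_neq0 // gram_det_gt0.
  apply/swap_relP/swap_relP => -[i [j [iS jS TE]]] lt_ST; exists i, j; split=> //;
  by move: lt_ST; rewrite mul1r ltr_ln // posrE vol_gt0.
split=> //; last by rewrite ltr_pdivrMr //; lra.
move=> Sopt S [cardSopt maxSopt]; rewrite (eq_output sameX).
move=> /output_one_interchange[cardS optS].
have f0 : 0 <= logvol (colset X set0).
  by rewrite /logvol /vol -/(gram_det _ _) gram_det0 sqrtr1 ln1.
have S_gt0 : (0 < #|S|)%N by rewrite cardS.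
have bound := interchange_bound (logvol_nondecreasing X_expand)
  (logvol_submodular X_expand) f0 (etrans cardSopt (esym cardS)) S_gt0 optS.
have kE : #|S|%:R = k%:R :> R by rewrite cardS.
rewrite kE in bound; rewrite subr_ge0 maxSopt //= mulrAC ler_pdivlMr //.
by move: bound; lra.
Qed.
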